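(* Let $\{\mathcal{S}(t)\}_{t\ge0}$ be the generalized Skellam process with state probabilities $p(n,t)=\Pr\{\mathcal{S}(t)=n\}$, and let $\{D_f(t)\}_{t\ge0}$ be an independent Lévy subordinator with $\mathbb{E}(D_f^r(t))<\infty$ for all $r>0$. Let $\mathcal{Z}_f(t)=\mathcal{S}(D_f(t))$. Then the state probabilities $p_f(n,t)=\Pr\{\mathcal{Z}_f(t)=n\}$ are given by $$p_f(n,t)=\sum_{m=\max(0,-n)}^{\infty}\frac{\Lambda^{m+n}\bar\Lambda^{m}}{(m+n)!\,m!}\,\mathbb{E}\big(e^{-(\Lambda+\bar\Lambda)D_f(t)}D_f^{2m+n}(t)\big),\qquad n\in\mathbb{Z}.$$
   Context: Fix an integer $k\ge1$ and positive rates $\lambda_1,\dots,\lambda_k,\mu_1,\dots,\mu_k$; $\Lambda=\lambda_1+\dots+\lambda_k$, $\bar\Lambda=\mu_1+\dots+\mu_k$. The generalized counting process (GCP) with rates $\lambda_1,\dots,\lambda_k$ is a Lévy process started at $0$ performing jumps of size $j\in\{1,\dots,k\}$ at rate $\lambda_j$. The generalized Skellam process (GSP) is $\mathcal{S}(t)=M_1(t)-M_2(t)$, with $M_1,M_2$ independent GCPs with rates $\lambda_j$ and $\mu_j$, respectively. The paper uses throughout the following formula for the state probabilities of the GSP: $p(n,t)=e^{-(\Lambda+\bar\Lambda)t}(\Lambda/\bar\Lambda)^{n/2}I_{|n|}(2t\sqrt{\Lambda\bar\Lambda})$, $n\in\mathbb{Z}$, where $I_n(x)=\sum_{j\ge0}\frac{(x/2)^{2j+n}}{j!(j+n)!}$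 is the modified Bessel function of the first kind. A Lévy subordinator $\{D_f(t)\}_{t\ge0}$ is a one-dimensional Lévy process with non-decreasing sample paths, $D_f(0)=0$ a.s., and $\mathbb{E}(e^{-sD_f(t)})=e^{-tf(s)}$, $s>0$, where $f$ is its Bernštein function. The process $\mathcal{Z}_f$ is called the time-changed generalized Skellam process-I (TCGSP-I).
   Formalization: The Bessel formula for p(n,t) fails for a generalized Skellam process when k ≥ 2, so it is an explicit hypothesis on S; the result is also stated for any càdlàg integer-valued process, independent of the subordinator, with these state probabilities. *)

(* Defs.v *)
From HB Require Import structures.
From mathcomp Require Import all_boot all_order all_algebra.
From mathcomp Require Import all_classical all_reals all_analysis.

Set Implicit Arguments.
Unset Strict Implicit.
Unset Printing Implicit Defensive.

Import Order.TTheory GRing.Theory Num.Theory.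
Import numFieldNormedType.Exports.

Local Open Scope classical_set_scope.
Local Open Scope ring_scope.

(* Processes are families [R -> T -> _]; only times [0 <= t] are ever
   constrained. *)

Section Processes.
Context {R : realType} {d : measure_display} {T : measurableType d}.

Definition is_process (X : R -> T -> R) : Prop :=
  forall t : R, 0 <= t -> measurable_fun [set: T] (X t).

Definition cadlag (X : R -> T -> R) : Prop :=
  forall w,
    (forall t : R, 0 <= t -> X s w @[s --> t^'+] --> X t w) /\
    (forall t : R, 0 < t -> cvg (X s w @[s --> t^'-])).

(* The sigma-algebra generated by [X t], [0 <= t]. *)
Definition process_sigma (X : R -> T -> R) : set (set T) :=
  <<s [set A | exists (t : R) (B : set R),
         [/\ 0 <= t, measurable B & A = X t @^-1` B]] >>.

Definition indep_processes (P : probability T R) (X Y : R -> T -> R) : Prop :=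
  forall A B, process_sigma X A -> process_sigma Y B ->
    P (A `&` B) = (P A * P B)%E.

(* Mutual independence of finitely many increments; sub-families are obtained
   by taking [B i = setT]. *)
Definition indep_increments (P : probability T R) (X : R -> T -> R) : Prop :=
  forall (t : nat -> R) (n : nat) (B : nat -> set R),
    0 <= t 0%N -> (forall i, t i <= t i.+1) -> (forall i, measurable (B i)) ->
    P [set w | forall i, (i < n)%N -> B i (X (t i.+1) w - X (t i) w)] =
    (\prod_(i < n) P [set w | B i (X (t i.+1) w - X (t i) w)%R])%E.

Definition stationary_increments (P : probability T R) (X : R -> T -> R) :
    Prop :=
  forall (s h : R) (B : set R), 0 <= s -> 0 <= h -> measurable B ->
    P [set w | B (X (s + h) w - X s w)] = P [set w | B (X h w - X 0 w)].

(* Stochastic continuity follows from right-continuity of the paths and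
   stationarity of the increments. *)
Record is_levy (P : probability T R) (X : R -> T -> R) : Prop := IsLevy {
  levy_process : is_process X ;
  levy_start : {ae P, forall w, X 0 w = 0} ;
  levy_indep : indep_increments P X ;
  levy_stationary : stationary_increments P X ;
  levy_cadlag : cadlag X }.

Definition is_bernstein (f : R -> R) : Prop :=
  [/\ forall s : R, 0 < s -> 0 <= f s,
      forall (n : nat) (s : R), 0 < s -> derivable (derive1n n f) s 1 &
      forall (n : nat) (s : R), 0 < s -> 0 <= (-1) ^+ n * derive1n n.+1 f s].

(* [D] takes values in [0, oo[ everywhere, so that it can serve as a time;
   it starts at 0 almost surely, by [is_levy]. *)
Record is_subordinator (P : probability T R) (f : R -> R) (D : R -> T -> R) :
    Prop := IsSubordinator {
  sub_levy : is_levy P D ;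
  sub_ge0 : forall (t : R) w, 0 <= t -> 0 <= D t w ;
  sub_nondecreasing : forall (s t : R) w,
    0 <= s -> s <= t -> D s w <= D t w ;
  sub_bernstein : is_bernstein f ;
  sub_laplace : forall s t : R, 0 < s -> 0 <= t ->
    ('E_P[fun w => expR (- s * D t w)%R] = (expR (- t * f s))%:E)%E }.

Definition nat_process (M : R -> T -> nat) : R -> T -> R :=
  fun t w => (M t w)%:R.

Definition int_process (S : R -> T -> int) : R -> T -> R :=
  fun t w => (S t w)%:~R.

Definition total_rate (k : nat) (lam : 'I_k -> R) : R := \sum_(j < k) lam j.

(* Jumps of size [j.+1], [j : 'I_k], occur at rate [lam j]:
     P(M(h) = 0) = 1 - Lambda h + o(h),  P(M(h) = j) = lambda_j h + o(h)
   as h -> 0+; hence P(M(h) > k) = o(h). *)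
Record is_GCP (P : probability T R) (k : nat) (lam : 'I_k -> R)
    (M : R -> T -> nat) : Prop := IsGCP {
  gcp_levy : is_levy P (nat_process M) ;
  gcp_no_jump :
    (fun h : R => fine (P [set w | M h w = 0%N]) - (1 - total_rate lam * h))
      =o_ (0^'+) (fun h : R => h) ;
  gcp_jump : forall j : 'I_k,
    (fun h : R => fine (P [set w | M h w = j.+1]) - lam j * h)
      =o_ (0^'+) (fun h : R => h) }.

Definition is_GSP (P : probability T R) (k : nat) (lam mu : 'I_k -> R)
    (S : R -> T -> int) : Prop :=
  exists M1 M2 : R -> T -> nat,
    [/\ is_GCP P lam M1, is_GCP P mu M2,
        indep_processes P (nat_process M1) (nat_process M2) &
        forall (t : R) w, 0 <= t -> S t w = (M1 t w)%:Z - (M2 t w)%:Z].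

Definition time_change (U : Type) (S : R -> T -> U) (D : R -> T -> R) :
    R -> T -> U :=
  fun t w => S (D t w) w.

End Processes.

Section Formulas.
Context {R : realType}.

(* Modified Bessel function of the first kind, of natural order. *)
Definition besselI (n : nat) (x : R) : R :=
  limn (series (fun j : nat => (x / 2) ^+ (2 * j + n) / (j`! * (j + n)`!)%:R)).

Definition skellam_prob (L M : R) (n : int) (t : R) : R :=
  expR (- (L + M) * t) * (L / M) `^ (n%:~R / 2)
  * besselI `|n|%N (2 * t * Num.sqrt (L * M)).

Definition has_skellam_probs (d : measure_display) (T : measurableType d)
    (P : probability T R) (L M : R) (S : R -> T -> int) : Prop :=
  forall (n : int) (t : R), 0 <= t ->
    P [set w | S t w = n] = (skellam_prob L M n t)%:E.

(* The summation index satisfies m >= max(0, -n), so that m + n and 2 m + n are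
   natural numbers and [absz] is a mere cast. *)
Definition time_changed_prob (d : measure_display) (T : measurableType d)
    (P : probability T R) (L M : R) (D : R -> T -> R) (n : int) (t : R) :
    \bar R :=
  (\sum_(absz (Num.max 0 (- n))%R <= m <oo)
     (L ^+ absz (m%:Z + n) * M ^+ m
        / ((absz (m%:Z + n)%R)`! * m`!)%:R)%:E
     * 'E_P[fun w => (expR (- (L + M) * D t w)
                      * D t w ^+ absz ((2 * m)%:Z + n))%R])%E.

End Formulas.

(* Main.v *)
(* Conditioning on D(t) gives P(S(D(t)) = n) = E(p(n, D(t))). Independence yields
   this at once when D(t) is replaced by the next point of the grid of mesh
   1/(m+1), which takes countably many values. These points tend to D(t)
   strictly from the right, so an integer-valued right-continuous path is
   eventually constant along them, and dominated convergence applies on both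
   sides. The power series of the Bessel function has nonnegative terms and is
   then integrated termwise by monotone convergence. *)

Require Import Defs.
From HB Require Import structures.
From mathcomp Require Import all_boot all_order all_algebra.
From mathcomp Require Import all_classical all_reals all_analysis.
From mathcomp Require Import measurable_realfun zify ring.

Import Order.TTheory GRing.Theory Num.Theory.
Import numFieldNormedType.Exports.

Local Open Scope classical_set_scope.
Local Open Scope ring_scope.

(** * Events that are eventually constant at each point *)

(** [B] is the lower limit of the [A m]: a countable union of countable intersections. *)
Lemma measurable_near_eq (d : measure_display) (T : measurableType d)
    (A : nat -> set T) (B : set T) :
  (forall m, measurable (A m)) ->
  (forall w, \forall m \near \oo, A m w <-> B w) ->
  measurable B.
Proof.
move=> mA AB.
have -> : B = \bigcup_N \bigcap_(m in [set m | (N <= m)%N]) A m.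
  apply/seteqP; split => [w Bw|w [N _ Aw]].
    have [N _ hN] := AB w.
    by exists N => // m Nm; apply/(hN m Nm).
  have [N' _ hN'] := AB w.
  apply/(hN' (maxn N N')); first exact: leq_maxr.
  by apply: Aw; exact: leq_maxl.
apply: bigcup_measurable => N _; by apply: bigcap_measurable => //; exists N => /=.
Qed.

(** At each point the indicators of the [A m] are eventually constant; they are bounded by 1, so
    dominated convergence applies. *)
Lemma cvg_probability_near_eq (R : realType) (d : measure_display)
    (T : measurableType d) (P : probability T R)
    (A : nat -> set T) (B : set T) :
  (forall m, measurable (A m)) ->
  (forall w, \forall m \near \oo, A m w <-> B w) ->
  P (A m) @[m --> \oo] --> P B.
Proof.
move=> mA AB; have mB := measurable_near_eq _ _ _ _ mA AB.
have PE C : measurable C -> P C = (\int[P]_x (\1_C x)%:E)%E.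
  by move=> mC; rewrite integral_indic// setIT.
rewrite PE//; under eq_fun do rewrite PE//.
apply: (@dominated_cvg _ _ _ P setT _ _ _ (cst 1%E)) => //.
- by move=> m; by apply/measurable_EFinP; exact: measurable_indic.
- move=> w _; apply: cvg_near_cst; apply: filterS (AB w) => m AmB.
  rewrite !indicE; congr (_%:R%:E); congr nat_of_bool.
  by apply/idP/idP; rewrite !inE => /AmB.
- exact: finite_measure_integrable_cst.
- by move=> m w _; rewrite indicE; case: (w \in A m); rewrite /= ?normr1 ?normr0 lee_fin.
Qed.

(** * Events selected by a random index *)

Lemma measurable_fun_nat_fibers (d : measure_display) (T : measurableType d)
    (N : T -> nat) :
  (forall j, measurable (N @^-1` [set j])) -> measurable_fun setT N.
Proof.
move=> mN _ Y _; rewrite setTI.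
have -> : N @^-1` Y = \bigcup_(j in Y) N @^-1` [set j].
  by apply/seteqP; split => [w Yw|w [j Yj /= ->]] //; exists (N w).
exact: bigcup_measurable.
Qed.

Lemma probability_frozen_index (R : realType) (d : measure_display)
    (T : measurableType d) (P : probability T R)
    (N : T -> nat) (E : nat -> set T) :
  measurable_fun setT N -> (forall j, measurable (E j)) ->
  (forall j, P (E j `&` N @^-1` [set j]) = P (E j) * P (N @^-1` [set j]))%E ->
  measurable [set w | E (N w) w] /\
  P [set w | E (N w) w] = (\int[P]_w P (E (N w)))%E.
Proof.
move=> mN mE indep.
have mNj j : measurable (N @^-1` [set j]) by rewrite -[X in measurable X]setTI; exact: mN.
have -> : [set w | E (N w) w] = \bigcup_j (E j `&` N @^-1` [set j]).
  by apply/seteqP; split => [w Ew|w [j _ [Ew /= ->]]] //; exists (N w).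
have mEN j : measurable (E j `&` N @^-1` [set j]) by exact: measurableI.
split; first exact: bigcup_measurable.
rewrite measure_semi_bigcup//; last 2 first.
- by move=> i j _ _ [w [[_ /= <-] [_ /= <-]]].
- exact: bigcup_measurable.
have NT : setT = \bigcup_j N @^-1` [set j].
  by apply/seteqP; split => // w _; exists (N w).
rewrite [in RHS]NT ge0_integral_bigcup -?NT//; last 2 first.
- by apply: (@measurableT_comp _ _ _ _ _ _ (fun j => P (E j)) _ N).
- by move=> i j _ _ [w [/= <- <-]].
apply: eq_eseriesr => j _; rewrite [LHS]indep -integral_cst//.
by apply: eq_integral => w; rewrite inE /= => ->.
Qed.

(** * Approximation of a time from the right *)

Section DiscretizedTime.
Context {R : realType}.

(* The least point of the grid of mesh [1 / m.+1] that is larger than [x]. *)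
Definition grid (m : nat) (x : R) : R :=
  (Num.truncn (m.+1%:R * x)).+1%:R / m.+1%:R.

Lemma grid_gt (m : nat) (x : R) : x < grid m x.
Proof.
by rewrite /grid ltr_pdivlMr ?ltr0Sn// mulrC truncnS_gt.
Qed.

Lemma cvg_grid (x : R) : 0 <= x -> grid m x @[m --> \oo] --> x.
Proof.
move=> x0; apply: (@squeeze_cvgr _ _ _ _ (cst x) (fun m => x + harmonic m)).
- apply: nearW => m; rewrite (ltW (grid_gt _ _)) /=.
  rewrite /grid /harmonic ler_pdivrMr ?ltr0Sn// mulrDl mulVf ?pnatr_eq0//.
  rewrite -natr1 lerD2r mulrC.
  (* Nonnegativity of [x] enters here: on negative numbers [Num.truncn] is 0 and exceeds its
     argument. *)
  by have /andP[] := truncn_itv (mulr_ge0 (ler0n R m.+1) x0); rewrite mulrC.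
- exact: cvg_cst.
- by rewrite -[X in _ --> X]addr0; apply: cvgD; [exact: cvg_cst|exact: cvg_harmonic].
Qed.

(** Integers at distance less than 1 coincide. The inequality [x < u m] is strict because the filter
    [x^'+] leaves out [x]. *)
Lemma cvg_right_int (s : R -> int) (u : nat -> R) (x : R) (n : int) :
  (s y)%:~R @[y --> x^'+] --> ((s x)%:~R : R) ->
  (forall m, x < u m) -> u m @[m --> \oo] --> x ->
  \forall m \near \oo, s (u m) = n <-> s x = n.
Proof.
move=> /cvg_at_rightP rc xu ux.
have /cvgrPdist_lt/(_ 1 ltr01) := rc u (conj xu ux).
apply: filterS => m.
rewrite -intrB -intr_norm ltrz1 => dist_lt1.
by have -> : s (u m) = s x by lia.
Qed.

End DiscretizedTime.

(** * Power series of the Skellam probabilities *)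

(** As (j + n)! is at least 1, a multiple of the exponential series at [(x / 2) ^+ 2] dominates. *)
Lemma cvg_skellam_series (R : realType) (n : nat) (x : R) : 0 <= x ->
  cvgn (series (fun j => (x / 2) ^+ (2 * j + n) / (j`! * (j + n)`!)%:R)).
Proof.
move=> x0; have y0 : 0 <= x / 2 by rewrite divr_ge0.
apply: (@series_le_cvg _ _ (((x / 2) ^+ n) *: exp_coeff ((x / 2) ^+ 2))).
- by move=> j; rewrite divr_ge0 ?exprn_ge0.
- by move=> j; rewrite mulr_ge0 ?exprn_ge0 ?exp_coeff_ge0 ?exprn_ge0.
- move=> j; rewrite exp_coeffE exprD exprM [_ * _ ^+ n]mulrC -mulrA.
  rewrite [leRHS]/GRing.scale/= ler_wpM2l ?exprn_ge0//.
  rewrite [leRHS]mulrC ler_wpM2l ?exprn_ge0 ?exprn_ge0//.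
  by rewrite lef_pV2 ?posrE ?ltr0n ?muln_gt0 ?fact_gt0// ler_nat leq_pmulr ?fact_gt0.
- by apply: is_cvg_seriesZ; exact: is_cvg_series_exp_coeff.
Qed.

Lemma powR_half_nat (R : realType) (a : R) (n : nat) : 0 <= a ->
  a `^ (n%:R / 2) = Num.sqrt a ^+ n.
Proof.
by move=> a0; rewrite [_ / 2]mulrC powRrM powR12_sqrt// powR_mulrn// sqrtr_ge0.
Qed.

(** The shift from [j] to [m] makes {j, j + |n|} equal to {m, m + n} for either sign of [n], and 2j
    + |n| equal to 2m + n. The half-integer powers cancel because sqrt(L/M) sqrt(LM) = L and
    sqrt(M/L) sqrt(LM) = M. *)
Lemma skellam_term (R : realType) (L M x : R) (n : int) (j : nat) :
  0 < L -> 0 < M -> 0 <= x ->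
  let m := (j + absz (Num.max 0 (- n))%R)%N in
  (L / M) `^ (n%:~R / 2) *
    ((2 * x * Num.sqrt (L * M) / 2) ^+ (2 * j + `|n|%N) / (j`! * (j + `|n|%N)`!)%:R)
  = L ^+ absz (m%:Z + n) * M ^+ m / ((absz (m%:Z + n)%R)`! * m`!)%:R
    * x ^+ absz ((2 * m)%:Z + n).
Proof.
move=> L0 M0 x0.
have sqrtLM : Num.sqrt (L * M) ^+ 2 = L * M by rewrite sqr_sqrtr// mulr_ge0 ?ltW.
have -> : 2 * x * Num.sqrt (L * M) / 2 = x * Num.sqrt (L * M) by field.
(* The even part of the exponent gives (LM)^j; the remaining sqrt(LM)^|n| is left to combine with
   the prefactor. *)
rewrite exprMn [Num.sqrt _ ^+ _]exprD exprM sqrtLM exprMn.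
case: n => n; lazy zeta.
- have -> : absz (Num.max 0 (- n%:Z)) = 0%N by lia.
  rewrite addn0.
  have -> : absz (j%:Z + n) = (j + n)%N by lia.
  have -> : absz ((2 * j)%N%:Z + n) = (2 * j + n)%N by lia.
  have -> : (L / M) `^ ((n%:Z)%:~R / 2) = Num.sqrt (L / M) ^+ n.
    by rewrite -pmulrn powR_half_nat// divr_ge0// ltW.
  have LE : Num.sqrt (L / M) * Num.sqrt (L * M) = L.
    rewrite -sqrtrM; last by rewrite divr_ge0// ltW.
    have -> : L / M * (L * M) = L ^+ 2 by field; rewrite gt_eqF.
    by rewrite sqrtr_sqr ger0_norm// ltW.
  have Ln : L ^+ n = Num.sqrt (L / M) ^+ n * Num.sqrt (L * M) ^+ n.
    by rewrite -exprMn LE.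
  by rewrite /absz [L ^+ (j + n)]exprD Ln [(_`! * j`!)%N]mulnC; ring.
(* For negative index the prefactor is inverted, so the surplus power falls on [M] instead of
   [L]. *)
- have -> : absz (Num.max 0 (- Negz n)) = n.+1 by lia.
  have -> : absz ((j + n.+1)%N%:Z + Negz n) = j by lia.
  have -> : absz ((2 * (j + n.+1))%N%:Z + Negz n) = (2 * j + n.+1)%N by lia.
  rewrite /absz.
  have -> : (L / M) `^ ((Negz n)%:~R / 2) = Num.sqrt (M / L) ^+ n.+1.
    rewrite NegzE mulrNz mulNr powRN -pmulrn powR_half_nat; last by rewrite divr_ge0// ltW.
    by rewrite -exprVn -sqrtrV ?invf_div// divr_ge0// ltW.
  have ME : Num.sqrt (M / L) * Num.sqrt (L * M) = M.
    rewrite -sqrtrM; last by rewrite divr_ge0// ltW.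
    have -> : M / L * (L * M) = M ^+ 2 by field; rewrite gt_eqF.
    by rewrite sqrtr_sqr ger0_norm// ltW.
  have Mn : M ^+ n.+1 = Num.sqrt (M / L) ^+ n.+1 * Num.sqrt (L * M) ^+ n.+1.
    by rewrite -exprMn ME.
  by rewrite [M ^+ (j + _)]exprD Mn; ring.
Qed.

(** Brings the exponential inside the sum and separates the coefficients from the factors in [x],
    ready for termwise integration. *)
Lemma skellam_prob_series (R : realType) (L M x : R) (n : int) :
  0 < L -> 0 < M -> 0 <= x ->
  (skellam_prob L M n x)%:E =
  (\sum_(absz (Num.max 0 (- n))%R <= m <oo)
     (L ^+ absz (m%:Z + n) * M ^+ m
        / ((absz (m%:Z + n)%R)`! * m`!)%:R)%:E
     * (expR (- (L + M) * x) * x ^+ absz ((2 * m)%:Z + n))%:E)%E.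
Proof.
move=> L0 M0 x0; rewrite -nneseries_addn; last first.
  move=> m; rewrite -EFinM lee_fin !mulr_ge0 ?exprn_ge0 ?expR_ge0 ?invr_ge0//; exact: ltW.
have y0 : 0 <= 2 * x * Num.sqrt (L * M) by rewrite !mulr_ge0.
have c0 : 0 <= expR (- (L + M) * x) * (L / M) `^ (n%:~R / 2).
  by rewrite mulr_ge0 ?expR_ge0 ?powR_ge0.
(* The limit in [besselI] is taken among the reals; it agrees with the extended one only because the
   series converges. *)
rewrite /skellam_prob /besselI EFinM -EFin_lim; last exact: cvg_skellam_series.
have -> : EFin \o series (fun j => (2 * x * Num.sqrt (L * M) / 2) ^+ (2 * j + `|n|)
      / (j`! * (j + `|n|)`!)%:R) =
    (fun N => \sum_(0 <= j < N) ((2 * x * Num.sqrt (L * M) / 2) ^+ (2 * j + `|n|)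
      / (j`! * (j + `|n|)`!)%:R)%:E)%E.
  by apply/funext => N; rewrite /= /series/= sumEFin.
rewrite -nneseriesZl; last first.
  by move=> j _; rewrite lee_fin divr_ge0// exprn_ge0// divr_ge0.
apply: eq_eseriesr => j _; rewrite -!EFinM; congr EFin.
rewrite -[LHS]mulrA skellam_term//; ring.
Qed.

(** * Conditioning on the random time *)

Lemma process_sigma_preimage (R : realType) (d : measure_display)
    (T : measurableType d) (X : R -> T -> R) (t : R) (B : set R) :
  0 <= t -> measurable B -> process_sigma X (X t @^-1` B).
Proof. by move=> t0 mB; apply: sub_sigma_algebra; exists t, B. Qed.

(** Puts the event in the form of a preimage of a Borel set, to which [is_process] and
    [process_sigma] apply. *)
Lemma int_process_fiber (R : realType) (T : Type) (S : R -> T -> int)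
    (t : R) (n : int) :
  [set w | S t w = n] = (fun w => (S t w)%:~R : R) @^-1` [set n%:~R].
Proof.
by apply/seteqP; split => [w /= -> //|w /= /eqP]; rewrite eqr_int => /eqP.
Qed.

Section TimeChange.
Context (R : realType) (d : measure_display) (T : measurableType d)
  (P : probability T R) (S : R -> T -> int) (D : R -> T -> R).
Hypotheses (mS : is_process (int_process S)) (cS : cadlag (int_process S))
  (mD : is_process D) (D0 : forall (t : R) w, 0 <= t -> 0 <= D t w)
  (indep : indep_processes P (int_process S) D).

Let measurable_fiber (t : R) (n : int) :
  0 <= t -> measurable [set w | S t w = n].
Proof.
move=> t0; rewrite int_process_fiber -[X in measurable X]setTI.
exact: (mS t).
Qed.

Let near_fiber (x : R) (u : nat -> R) (n : int) w : 0 <= x ->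
  (forall m, x < u m) -> u m @[m --> \oo] --> x ->
  \forall m \near \oo, S (u m) w = n <-> S x w = n.
Proof.
move=> x0; apply: (@cvg_right_int R (S ^~ w)).
by have [+ _] := cS w; exact.
Qed.

(** By unfolding, [grid m (D t w)] is [(cell m t w).+1%:R / m.+1%:R]. *)
Let cell (m : nat) (t : R) (w : T) : nat := Num.truncn (m.+1%:R * D t w).

(** Shows that the event belongs to the sigma-algebra generated by [D]. *)
Let cell_fiber m t j : 0 <= t ->
  cell m t @^-1` [set j] = D t @^-1` `[j%:R / m.+1%:R, j.+1%:R / m.+1%:R[.
Proof.
move=> t0; apply/seteqP; split => w /=; rewrite in_itv/= ler_pdivrMr ?ltr0Sn//
  ltr_pdivlMr ?ltr0Sn// ![_ * m.+1%:R]mulrC -truncn_eq ?mulr_ge0 ?D0// => /eqP//.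
Qed.

(** This is [probability_frozen_index] with index [cell m t]; independence of the processes supplies
    the factorization at each [j]. *)
Lemma probability_grid_time_change (n : int) (t : R) (m : nat) : 0 <= t ->
  measurable [set w | S (grid m (D t w)) w = n] /\
  P [set w | S (grid m (D t w)) w = n] =
    (\int[P]_w P [set v | S (grid m (D t w)) v = n])%E.
Proof.
move=> t0.
have q0 j : 0 <= j.+1%:R / m.+1%:R :> R by rewrite divr_ge0.
apply: (@probability_frozen_index R d T P (cell m t)
  (fun j => [set w | S (j.+1%:R / m.+1%:R) w = n])).
- apply: measurable_fun_nat_fibers => j; rewrite cell_fiber//.
  by rewrite -[X in measurable X]setTI; exact: (mD t).
- by move=> j; exact: measurable_fiber.
- move=> j; apply: indep.
  + by rewrite int_process_fiber; exact: process_sigma_preimage.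
  + by rewrite cell_fiber//; exact: process_sigma_preimage.
Qed.

Lemma probability_time_change (n : int) (t : R) : 0 <= t ->
  P [set w | time_change S D t w = n] =
    (\int[P]_w P [set v | S (D t w) v = n])%E.
Proof.
move=> t0.
have grid0 m w : 0 <= grid m (D t w).
  by rewrite (le_trans (D0 t w t0))// ltW// grid_gt.
have lhs : P [set w | S (grid m (D t w)) w = n] @[m --> \oo]
    --> P [set w | time_change S D t w = n].
  apply: cvg_probability_near_eq => [m|w].
    by have [] := probability_grid_time_change n t m t0.
  apply: near_fiber; [exact: D0|by move=> m; exact: grid_gt|].
  by apply: cvg_grid; exact: D0.
have rhs : (\int[P]_w P [set v | S (grid m (D t w)) v = n])%E @[m --> \oo]
    --> (\int[P]_w P [set v | S (D t w) v = n])%E.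
  apply: (@dominated_cvg _ _ _ P setT _ _ _ (cst 1%E)) => //.
  (* The integrand is a function of the discrete variable [cell m t], hence measurable. *)
  - move=> m; apply: (@measurableT_comp _ _ _ _ _ _
      (fun j => P [set v | S (j.+1%:R / m.+1%:R) v = n]) _ (cell m t)) => //.
    apply: measurable_fun_nat_fibers => j; rewrite cell_fiber//.
    by rewrite -[X in measurable X]setTI; exact: (mD t).
  (* With [w] fixed, [D t w] is a deterministic time; right-continuity is now used along the path of
     each [v]. *)
  - move=> w _; apply: cvg_probability_near_eq => [m|v].
      exact: measurable_fiber.
    apply: near_fiber; [exact: D0|by move=> m; exact: grid_gt|].
    by apply: cvg_grid; exact: D0.
  - exact: finite_measure_integrable_cst.
  - move=> m w _; rewrite gee0_abs//.
    by apply: probability_le1; exact: measurable_fiber.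
have gridE : (fun m => P [set w | S (grid m (D t w)) w = n]) =
    (fun m => \int[P]_w P [set v | S (grid m (D t w)) v = n])%E.
  by apply/funext => m; have [] := probability_grid_time_change n t m t0.
by move: lhs; rewrite gridE => lhs; exact: cvg_unique lhs rhs.
Qed.

Lemma skellam_time_change (L M : R) (n : int) (t : R) :
  0 < L -> 0 < M -> has_skellam_probs P L M S -> 0 <= t ->
  P [set w | time_change S D t w = n] = time_changed_prob P L M D n t.
Proof.
move=> L0 M0 pS t0; rewrite probability_time_change// /time_changed_prob.
pose coef m : R := L ^+ absz (m%:Z + n) * M ^+ m
  / ((absz (m%:Z + n)%R)`! * m`!)%:R.
pose moment m w : R :=
  expR (- (L + M) * D t w) * D t w ^+ absz ((2 * m)%:Z + n).
have coef_ge0 m : 0 <= coef m.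
  by rewrite !mulr_ge0 ?exprn_ge0 ?invr_ge0//; exact: ltW.
have moment_ge0 m w : (0 <= (moment m w)%:E)%E.
  by rewrite lee_fin mulr_ge0 ?expR_ge0 ?exprn_ge0 ?D0.
have measurable_moment m : measurable_fun setT (fun w => (moment m w)%:E).
  apply/measurable_EFinP; apply: measurable_funM.
    by apply: measurableT_comp => //; apply: measurable_funM => //; exact: mD.
  by apply: measurable_funX; exact: mD.
set a := absz (Num.max 0 (- n)).
(* The sum is restarted at 0 through the index [m + a], so that monotone convergence for series
   applies. *)
transitivity (\int[P]_w
    \sum_(0 <= m <oo) ((coef (m + a)%N)%:E * (moment (m + a)%N w)%:E))%E.
  apply: eq_integral => w _.
  rewrite (pS _ _ (D0 _ _ t0)) skellam_prob_series ?D0//.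
  by rewrite -nneseries_addn// => m; rewrite mule_ge0 ?moment_ge0// lee_fin; exact: coef_ge0.
rewrite integral_nneseries//; last 2 first.
- by move=> m; exact: measurable_funeM.
- by move=> m w _; rewrite mule_ge0// lee_fin.
rewrite -[RHS]nneseries_addn; last first.
  move=> m; apply: mule_ge0; first by rewrite lee_fin; exact: coef_ge0.
  by rewrite unlock; apply: integral_ge0 => w _; exact: moment_ge0.
apply: eq_eseriesr => m _.
by rewrite ge0_integralZl_EFin// unlock.
Qed.

End TimeChange.

(** * Specialization to the generalized Skellam process *)

Lemma total_rate_gt0 (R : realType) (k : nat) (lam : 'I_k -> R) :
  (1 <= k)%N -> (forall j, 0 < lam j) -> 0 < total_rate lam.
Proof.
case: k lam => // k lam _ lam0; rewrite /total_rate big_ord_recl.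
by rewrite ltr_wpDr// sumr_ge0// => j _; exact: ltW.
Qed.

Lemma gsp_process (R : realType) (d : measure_display) (T : measurableType d)
    (P : probability T R) (k : nat) (lam mu : 'I_k -> R) (S : R -> T -> int) :
  is_GSP P lam mu S ->
  is_process (int_process S) /\ cadlag (int_process S).
Proof.
move=> [M1 [M2 [gM1 gM2 _ SE]]].
have [m1 c1] := (levy_process (gcp_levy gM1), levy_cadlag (gcp_levy gM1)).
have [m2 c2] := (levy_process (gcp_levy gM2), levy_cadlag (gcp_levy gM2)).
have SB t w : 0 <= t ->
    int_process S t w = nat_process M1 t w - nat_process M2 t w.
  by move=> t0; rewrite /int_process SE// intrB.
split=> [t t0|w].
  apply: (eq_measurable_fun (nat_process M1 t \- nat_process M2 t)).
    by move=> w _; rewrite /= SB.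
  by apply: measurable_funB; [exact: m1|exact: m2].
have [r1 l1] := c1 w; have [r2 l2] := c2 w; split=> t t0.
  rewrite SB//; apply: cvg_trans (cvgB (r1 t t0) (r2 t t0)).
  (* The difference formula is known at nonnegative times only; times to the right of [t] are
     such. *)
  apply: near_eq_cvg; near=> s; rewrite /= SB//.
  by rewrite (le_trans t0)// ltW.
apply: (cvgP _ (cvg_trans _ (cvgB (l1 t t0) (l2 t t0)))).
(* For left limits [t] is positive, so times close enough to [t] are positive too. *)
apply: near_eq_cvg; near=> s; rewrite /= SB//; apply: ltW.
by near: s; exact: nbhs_left_gt.
Unshelve. all: by end_near.
Qed.

(* The formula for the state probabilities of S is a hypothesis. For k >= 2 it
   is not satisfied by the difference of two independent generalized counting
   processes, so the theorem also covers, in its second part, every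
   integer-valued process with these state probabilities. *)
Theorem theorem3p1 (R : realType) (d : measure_display) (T : measurableType d)
    (P : probability T R) (k : nat) (hk : (1 <= k)%N)
    (lam mu : 'I_k -> R)
    (lam_gt0 : forall j, 0 < lam j) (mu_gt0 : forall j, 0 < mu j)
    (f : R -> R) (D : R -> T -> R)
    (hD : is_subordinator P f D)
    (D_moments : forall t r : R, 0 <= t -> 0 < r ->
       ('E_P[fun w => (D t w `^ r)%R] < +oo)%E) :
  (forall S : R -> T -> int,
     is_GSP P lam mu S ->
     has_skellam_probs P (total_rate lam) (total_rate mu) S ->
     indep_processes P (int_process S) D ->
     forall (n : int) (t : R), 0 <= t ->
       P [set w | time_change S D t w = n] =
       time_changed_prob P (total_rate lam) (total_rate mu) D n t) /\
  (forall S : R -> T -> int,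
     is_process (int_process S) -> cadlag (int_process S) ->
     has_skellam_probs P (total_rate lam) (total_rate mu) S ->
     indep_processes P (int_process S) D ->
     forall (n : int) (t : R), 0 <= t ->
       P [set w | time_change S D t w = n] =
       time_changed_prob P (total_rate lam) (total_rate mu) D n t).
Proof.
(* Common core of both parts; [gsp_process] reduces the first part to it. *)
have main S : is_process (int_process S) -> cadlag (int_process S) ->
    has_skellam_probs P (total_rate lam) (total_rate mu) S ->
    indep_processes P (int_process S) D ->
    forall (n : int) (t : R), 0 <= t ->
      P [set w | time_change S D t w = n] =
      time_changed_prob P (total_rate lam) (total_rate mu) D n t.
  move=> mS cS pS indep n t t0; apply: skellam_time_change => //.
  - exact: levy_process (sub_levy hD).
  - exact: sub_ge0 hD.
  - exact: total_rate_gt0.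
  - exact: total_rate_gt0.
by split=> // S /gsp_process[mS cS]; exact: main.
Qed.
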